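(* Let $L/k$ be a finite field extension, let $n\geq 1$, and let $C$ be an $L$-linear subspace of $L^n$. Then $$\mathrm{Res}(C)^\perp=\mathrm{Rsupp}(C^\perp),$$ where the orthogonal on the left is taken in $k^n$ and the orthogonal on the right is taken in $L^n$.
   Context: For an $L$-linear subspace $C\subset L^n$, its restriction is the $k$-subspace $\mathrm{Res}(C)=C\cap k^n$ of $k^n$. Orthogonals are taken with respect to the standard bilinear forms $\langle \mathbf{x},\mathbf{y}\rangle=\sum_j x_jy_j$ on $L^n$ and on $k^n$: for an $L$-subspace $C\subset L^n$, $C^\perp=\{\mathbf{d}\in L^n:\langle\mathbf{c},\mathbf{d}\rangle=0\ \forall\,\mathbf{c}\in C\}$, and similarly for $k$-subspaces of $k^n$. Rank support: let $m=[L:k]$ and fix a $k$-basis $\alpha_1,\ldots,\alpha_m$ of $L$. For $\mathbf{c}=(c_1,\ldots,c_n)\in L^n$ write $c_j=\sum_{i=1}^m c_{ij}\alpha_i$ with $c_{ij}\in k$, and let $M(\mathbf{c})=(c_{ij})$, an $m\times n$ matrix over $k$. Then $\mathrm{Rsupp}(\mathbf{c})$ is the $k$-subspace of $k^n$ spanned by the rows of $M(\mathbf{c})$ (independent of the choice of basis), and for an $L$-linear subspace $D\subset L^n$, $\mathrm{Rsupp}(D)$ is the $k$-subspace of $k^n$ spanned by all $\mathrm{Rsupp}(\mathbf{d})$, $\mathbf{d}\in D$. *)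

(* Defs.v *)
From HB Require Import structures.
From mathcomp Require Import all_boot all_order all_algebra all_field.
From mathcomp Require Import sesquilinear boolp classical_sets.

Set Implicit Arguments.
Unset Strict Implicit.
Unset Printing Implicit Defensive.

Import GRing.Theory.
Local Open Scope ring_scope.

Section StandardForm.
Variables (F : fieldType) (n : nat).
Implicit Types (u v : 'rV[F]_n) (C : {vspace 'rV[F]_n}).

Definition stdform u v : F := \sum_(j < n) u 0 j * v 0 j.

Fact stdform_linearl v : linear_for *%R (stdform^~ v).
Proof.
move=> a u w; rewrite /stdform mulr_sumr -big_split /=.
by apply: eq_bigr => j _; rewrite !mxE mulrDl mulrA.
Qed.

Fact stdformC u v : stdform u v = (-1) ^+ false * idfun (stdform v u).
Proof. by rewrite expr0 mul1r; apply: eq_bigr => j _; rewrite mulrC. Qed.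

Fact stdform_linearr u : linear_for (idfun \; *%R) (stdform u).
Proof.
move=> a v w; have C x : stdform u x = stdform x u.
  by rewrite stdformC expr0 mul1r.
by rewrite !C stdform_linearl.
Qed.

HB.instance Definition _ :=
  bilinear_isBilinear.Build F 'rV[F]_n 'rV[F]_n F *%R (idfun \; *%R) stdform
    (stdform_linearl, stdform_linearr).

HB.instance Definition _ :=
  isHermitianSesquilinear.Build F 'rV[F]_n false idfun stdform stdformC.

Definition orth C : {vspace 'rV[F]_n} := orthov stdform C.

Lemma mem_orthP C u :
  reflect (forall c, c \in C -> stdform c u = 0) (u \in orth C).
Proof.
by apply: (iffP mem_orthovP) => h c /h; rewrite stdformC expr0 mul1r.
Qed.

End StandardForm.

Section SpanOfSet.
Variables (F : fieldType) (vT : vectType F).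
Implicit Types (A : set vT) (U : {vspace vT}).

Lemma ex_finite_span A : exists s : seq vT,
  (forall v, v \in s -> A v) /\ (forall v, A v -> v \in <<s>>%VS).
Proof.
pose P d := `[< exists2 s : seq vT, (forall v, v \in s -> A v) &
                                     \dim <<s>> = d >].
have exP : exists d, P d.
  by exists (\dim <<[::] : seq vT>>); apply/asboolP; exists [::].
have ubP d : P d -> (d <= \dim {:vT})%N.
  by move=> /asboolP[s _ <-]; exact/dimvS/subvf.
case: (ex_maxnP exP ubP) => d /asboolP[s sA dims] maxd.
exists s; split=> // v Av.
have/eqP-> : (<<s>> == <<v :: s>>)%VS.
  rewrite eqEdim dims sub_span /=; last by move=> w ws; rewrite inE ws orbT.
  apply: maxd; apply/asboolP; exists (v :: s) => //.
  by move=> w; rewrite inE => /orP[/eqP->|/sA].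
by rewrite memv_span // mem_head.
Qed.

Lemma setspan_subproof A : exists U,
  (forall v, A v -> v \in U) /\
  (forall W : {vspace vT}, (forall v, A v -> v \in W) -> (U <= W)%VS).
Proof.
have [s [sA As]] := ex_finite_span A.
by exists <<s>>%VS; split=> // W AW; apply/span_subvP => v /sA/AW.
Qed.

(* The span of an arbitrary, possibly infinite, set of vectors: <<_>>%VS only
   takes finite sequences. It is the least subspace containing A. *)
Definition setspan A : {vspace vT} := projT1 (cid (setspan_subproof A)).

Lemma mem_setspan A v : A v -> v \in setspan A.
Proof. by rewrite /setspan; case: cid => U [/= + _]; exact. Qed.

Lemma setspan_sub A U : (forall v, A v -> v \in U) -> (setspan A <= U)%VS.
Proof. by rewrite /setspan; case: cid => W [/= _]; exact. Qed.

End SpanOfSet.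

Section Restriction.
Variables (k : fieldType) (L : fieldExtType k) (n : nat).
Implicit Types (C : {vspace 'rV[L]_n}) (x : 'rV[k]_n).

Lemma Res_subproof C : exists U : {vspace 'rV[k]_n},
  forall x, (x \in U) = (map_mx (in_alg L) x \in C).
Proof.
have [s [sC Cs]] :=
  ex_finite_span [set x | map_mx (in_alg L) x \in C]%classic.
exists <<s>>%VS => x; apply/idP/idP => [|/Cs //].
rewrite -[s]in_tupleE => /coord_span->.
rewrite raddf_sum; apply: memv_suml => i _ /=.
rewrite (map_mxZ (in_alg L)) memvZ //.
by apply: (sC _ (mem_nth _ _)); exact: ltn_ord.
Qed.

Definition Res C : {vspace 'rV[k]_n} := projT1 (cid (Res_subproof C)).

Lemma mem_Res C x : (x \in Res C) = (map_mx (in_alg L) x \in C).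
Proof. by rewrite /Res; case: cid => U /=. Qed.

End Restriction.

Section RankSupport.
Variables (k : fieldType) (L : fieldExtType k) (n m : nat).
Variable alpha : m.-tuple L.
Implicit Types (c : 'rV[L]_n) (D : {vspace 'rV[L]_n}).

(* Meaningful when alpha is a k-basis of L. *)
Definition coordmx c : 'M[k]_(m, n) := \matrix_(i, j) coord alpha i (c 0 j).

Definition vrsupp c : {vspace 'rV[k]_n} :=
  <<[seq row i (coordmx c) | i : 'I_m]>>%VS.

Definition Rsupp D : {vspace 'rV[k]_n} :=
  setspan [set x | exists2 d, d \in D & x \in vrsupp d]%classic.

End RankSupport.

(* Main.v *)
(* Both sides are biorthogonal subspaces of k^n, so it suffices to compare their
   orthogonals, i.e. to show Rsupp(C^perp)^perp = Res(C). For x in k^n and d in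
   L^n, <x, d> = \sum_i <x, row_i M(d)> alpha_i; since the alpha_i are linearly
   independent, x is orthogonal to d in L^n iff it is orthogonal to Rsupp(d).
   Thus x lies in Rsupp(C^perp)^perp iff it lies in C^perp^perp = C. *)
Require Import Defs.
From mathcomp Require Import all_boot all_order all_algebra all_field.

Import GRing.Theory.
Local Open Scope ring_scope.

Lemma stdform_sym (F : fieldType) (n : nat) (u v : 'rV[F]_n) :
  stdform u v = stdform v u.
Proof. by apply: eq_bigr => j _; rewrite mulrC. Qed.

(** For the nontrivial inclusion, let the rows of [B] form a basis of [U]. The transposed columns of
    [cokermx B] lie in [orth U], so a vector [v] orthogonal to [orth U] is killed by [cokermx B] and
    hence lies in the row space of [B]. *)
Lemma orthK (F : fieldType) (n : nat) : involutive (@orth F n).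
Proof.
move=> U; apply/vspaceP => v; apply/idP/idP => [/mem_orthP vP|vU]; last first.
  by apply/mem_orthP => d /mem_orthP dU; rewrite stdform_sym; exact: dU.
pose B := \matrix_(i < \dim U) (vbasis U)`_i.
have vB : (v <= B)%MS.
  rewrite submxE; apply/eqP/rowP => j; rewrite [RHS]mxE.
  have colE (w : 'rV[F]_n) :
      (w *m cokermx B) 0 j = stdform w (col j (cokermx B))^T.
    by rewrite mxE; apply: eq_bigr => i _; rewrite !mxE.
  rewrite colE stdform_sym; apply: vP.
  apply/mem_orthP => c /coord_vbasis ->; rewrite -colE.
  under eq_bigr => i _ do rewrite -[(vbasis U)`_i](rowK (fun i => (vbasis U)`_i)).
  rewrite mulmx_suml big1 ?mxE // => i _.
  by rewrite -scalemxAl -row_mul mulmx_coker row0 scaler0.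
case/submxP: vB => a ->; rewrite mulmx_sum_row.
apply: memv_suml => i _; rewrite rowK memvZ //.
by apply/vbasis_mem/mem_nth; rewrite size_tuple.
Qed.

Section RankSupport.
Variables (k : fieldType) (L : fieldExtType k) (n m : nat).
Variable alpha : m.-tuple L.
Hypothesis alphaP : basis_of {:L} alpha.

Lemma stdform_map_coordmx (x : 'rV[k]_n) (d : 'rV[L]_n) :
  stdform (map_mx (in_alg L) x) d =
  \sum_(i < m) stdform x (row i (coordmx alpha d)) *: alpha`_i.
Proof.
rewrite [LHS](eq_bigr (fun j => \sum_(i < m)
    (x 0 j * coordmx alpha d i j) *: alpha`_i)) => [|j _].
  rewrite exchange_big; apply: eq_bigr => i _.
  by rewrite scaler_suml; apply: eq_bigr => j _; rewrite !mxE.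
rewrite mxE /= mulr_algl [d 0 j in LHS](coord_basis alphaP (memvf _)).
by rewrite scaler_sumr; apply: eq_bigr => i _; rewrite mxE scalerA.
Qed.

Lemma mem_orth_vrsupp (x : 'rV[k]_n) (d : 'rV[L]_n) :
  (x \in orth (vrsupp alpha d)) = (stdform (map_mx (in_alg L) x) d == 0).
Proof.
have row_vrsupp i : row i (coordmx alpha d) \in vrsupp alpha d.
  by apply: memv_span; apply/imageP; exists i.
rewrite stdform_map_coordmx; apply/idP/eqP => [/mem_orthP xd|xd0].
  by rewrite big1 // => i _; rewrite stdform_sym xd ?scale0r.
have /freeP/(_ _ xd0) x0 := basis_free alphaP.
(* The vectors orthogonal to [x] form a subspace, so it is enough to check the rows that generate
   [vrsupp alpha d]. *)
suff /subvP rowsx : (vrsupp alpha d <= orth <[x]>)%VS.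
  apply/mem_orthP => c /rowsx /mem_orthP cx.
  by rewrite stdform_sym cx ?memv_line.
apply/span_subvP => _ /imageP[i _ ->].
by apply/mem_orthP => _ /vlineP[a ->]; rewrite linearZl_LR /= x0 mulr0.
Qed.

End RankSupport.

Theorem proposition2p11 (k : fieldType) (L : fieldExtType k)
    (alpha : (\dim {:L}).-tuple L) (alphaP : basis_of {:L} alpha)
    (n : nat) (hn : (1 <= n)%N) (C : {vspace 'rV[L]_n}) :
  orth (Res C) = Rsupp alpha (orth C).
Proof.
rewrite -[RHS]orthK; congr orth; apply/vspaceP => x.
rewrite mem_Res -[C in LHS]orthK.
apply/mem_orthP/mem_orthP => [xC|xR d dC].
  (* By minimality of [setspan], only the vectors of each [vrsupp alpha d] with [d] in [orth C] need
     checking. *)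
  suff /subvP Rx : (Rsupp alpha (orth C) <= orth <[x]>)%VS.
    by move=> r /Rx /mem_orthP rx; rewrite stdform_sym rx ?memv_line.
  apply: setspan_sub => r [d dC rd]; apply/mem_orthP => _ /vlineP[a ->].
  have /mem_orthP xd : x \in orth (vrsupp alpha d).
    by rewrite mem_orth_vrsupp // stdform_sym xC.
  by rewrite linearZl_LR /= stdform_sym xd ?mulr0.
(* Conversely, all of [vrsupp alpha d] is among the generators of [Rsupp alpha (orth C)], so [x] is
   orthogonal to it. *)
apply/eqP; rewrite stdform_sym -(mem_orth_vrsupp _ _ _ _ _ alphaP).
by apply/mem_orthP => r rd; apply: xR; apply: mem_setspan; exists d.
Qed.
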